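(* A family of $n$ conditional events $\mathcal{F}=\{E_1|H_1,\ldots,E_n|H_n\}$ is p-consistent if and only if the prevision assessment $\mathbb{P}[\mathcal{C}(\mathcal{F})]=1$ is coherent, where $\mathcal{C}(\mathcal{F})=(E_1|H_1)\wedge\cdots\wedge(E_n|H_n)$.
   Context: Events are two-valued propositions (identified with subsets of the sure event $\Omega$, and with their indicators); $\overline{A}$ is negation, $AB$ is conjunction. For events $E,H$ with $H\neq\emptyset$, the conditional event $E|H$ is true if $EH$ is true, false if $\overline{E}H$ is true, void if $\overline{H}$ is true. A conditional random quantity $X|H$ ($X$ with finitely many values, $H\ne\emptyset$) with assessed prevision $\mu=\mathbb{P}(X|H)$ is identified with the random quantity $XH+\mu\overline{H}$; in particular $E|H=EH+x\overline{H}$ with $x=P(E|H)$. Coherence: an assessment of previsions $\mu_j=\mathbb{P}(X_j|K_j)$ on a family of conditional random quantities is coherent if, for every finite subfamily $\{X_1|K_1,\ldots,X_r|K_r\}$ and all real $s_1,\ldots,s_r$, the gain $G=\sum_j s_jK_j(X_j-\mu_j)$ restricted to $K_1\vee\cdots\vee K_r$ satisfies $\min G\leq 0\leq\max G$. Conjunction. For each nonempty $S\subseteq\{1,\ldots,n\}$ let $x_S$ be the assessed prevision of $\mathcal{C}_S=\bigwedge_{i\in S}(E_i|H_i)$ ($x_{\{i\}}=P(E_i|H_i)$). $\mathcal{C}_S$ is the random quantity, conditional on $\bigvee_{i\in S}H_i$, with value $1$ if all $E_i|H_i$, $i\in S$, are true; $0$ if at least one is false; $x_V$ if none is false and the set $V\subseteq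 S$ of indices of void ones is nonempty (so its value is its prevision $x_S$ when all $H_i$, $i\in S$, are false). $\mathcal{C}(\mathcal{F})=\mathcal{C}_{\{1,\ldots,n\}}$. Convention: the numbers $x_S$ are always specified so as to form a coherent assessment on the family of all $\mathcal{C}_S$; accordingly, an assessment on a subfamily of the $\mathcal{C}_S$ (such as $\mathbb{P}[\mathcal{C}(\mathcal{F})]=1$) is coherent if it is the restriction of a coherent assessment $(x_S)_{\emptyset\neq S\subseteq\{1,\ldots,n\}}$ on the family of all $\mathcal{C}_S$. p-consistency: $\mathcal{F}$ is p-consistent if and only if the probability assessment $P(E_1|H_1)=\cdots=P(E_n|H_n)=1$ on $\mathcal{F}$ is coherent. *)

(* Defs.v *)
From mathcomp Require Import all_boot all_order all_algebra.
From mathcomp Require Import all_classical all_reals.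
From mathcomp Require Import numfun.

Set Implicit Arguments.
Unset Strict Implicit.
Unset Printing Implicit Defensive.

Import Order.TTheory GRing.Theory Num.Theory.
Local Open Scope classical_set_scope.
Local Open Scope ring_scope.

(** Events are the subsets of a sure event [Omega], which may be infinite. *)
Record cond_event (Omega : Type) := CondEvent {
  ce_event : set Omega;
  ce_hyp : set Omega;
  ce_hyp_neq0 : ce_hyp !=set0 }.

Definition ce_true (Omega : Type) (A : cond_event Omega) : set Omega :=
  ce_event A `&` ce_hyp A.
Definition ce_false (Omega : Type) (A : cond_event Omega) : set Omega :=
  ~` ce_event A `&` ce_hyp A.
Definition ce_void (Omega : Type) (A : cond_event Omega) : set Omega :=
  ~` ce_hyp A.

(** [X|K] with [X] finitely valued. The values of [X] outside [K] play no
    role: they are multiplied by the indicator of [K] in [gain], so that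
    replacing [X] by [XK + mu (~K)] changes nothing. *)
Record cond_quantity (Omega : Type) (R : realType) := CondQuantity {
  cq_val : Omega -> R;
  cq_val_finite : finite_set (range cq_val);
  cq_hyp : set Omega;
  cq_hyp_neq0 : cq_hyp !=set0 }.

Definition gain (Omega : Type) (R : realType) (r : nat)
    (Y : 'I_r -> cond_quantity Omega R) (mu s : 'I_r -> R) (w : Omega) : R :=
  \sum_(j < r) s j * (\1_(cq_hyp (Y j)) w * (cq_val (Y j) w - mu j)).

Definition is_minimum (R : realType) (A : set R) (m : R) := A m /\ lbound A m.
Definition is_maximum (R : realType) (A : set R) (m : R) := A m /\ ubound A m.

(** The finite subfamilies of [Y] are given by the injective [t]. *)
Definition coherent (Omega : Type) (R : realType) (J : Type)
    (Y : J -> cond_quantity Omega R) (mu : J -> R) : Prop :=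
  forall (r : nat) (t : 'I_r -> J) (s : 'I_r -> R),
    (0 < r)%N -> injective t ->
    let G := gain (Y \o t) (mu \o t) s in
    let K := \bigcup_(j in [set: 'I_r]) cq_hyp (Y (t j)) in
    exists m M : R,
      [/\ is_minimum (G @` K) m, is_maximum (G @` K) M & m <= 0 <= M].

Lemma indic_range_finite (Omega : Type) (R : realType) (A : set Omega) :
  finite_set (range (\1_A : Omega -> R)).
Proof. exact: sub_finite_set (@image_indic_sub _ R _ _) (finite_set2 _ _). Qed.

Definition ce_quantity (R : realType) (Omega : Type) (A : cond_event Omega) :
    cond_quantity Omega R :=
  CondQuantity (indic_range_finite R (ce_event A)) (ce_hyp_neq0 A).

Definition p_consistent (R : realType) (Omega : Type) (n : nat)
    (F : 'I_n -> cond_event Omega) : Prop :=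
  coherent (fun i : 'I_n => ce_quantity R (F i)) (fun=> 1).

Definition void_indices (Omega : Type) (n : nat) (F : 'I_n -> cond_event Omega)
    (S : {set 'I_n}) (w : Omega) : {set 'I_n} :=
  [set i in S | w \in ce_void (F i)]%SET.

(** In the last branch [void_indices F S w] is nonempty, so [x set0] is never
    used. *)
Definition conj_val (Omega : Type) (R : realType) (n : nat)
    (F : 'I_n -> cond_event Omega) (x : {set 'I_n} -> R) (S : {set 'I_n})
    (w : Omega) : R :=
  if [forall i in S, w \in ce_true (F i)] then 1
  else if [exists i in S, w \in ce_false (F i)] then 0
  else x (void_indices F S w).

Lemma conj_val_finite (Omega : Type) (R : realType) (n : nat)
    (F : 'I_n -> cond_event Omega) (x : {set 'I_n} -> R) (S : {set 'I_n}) :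
  finite_set (range (conj_val F x S)).
Proof.
apply: (@sub_finite_set _ _ ([set 1; 0] `|` range x)).
  move=> _ [w _ <-]; rewrite /conj_val.
  case: ifP => _; first by left; left.
  case: ifP => _; first by left; right.
  by right; exists (void_indices F S w).
by rewrite finite_setU; split; [exact: finite_set2 | exact: finite_image].
Qed.

Definition nonempty_set (n : nat) : Type := {S : {set 'I_n} | S != finset.set0}.

Lemma conj_hyp_neq0 (Omega : Type) (n : nat) (F : 'I_n -> cond_event Omega)
    (S : nonempty_set n) :
  \bigcup_(i in [set` val S]) ce_hyp (F i) !=set0.
Proof.
case: S => S /= /set0Pn[i iS]; have [w Hw] := ce_hyp_neq0 (F i).
by exists w; exists i.
Qed.

Definition conjunction (Omega : Type) (R : realType) (n : nat)
    (F : 'I_n -> cond_event Omega) (x : {set 'I_n} -> R) (S : nonempty_set n) :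
    cond_quantity Omega R :=
  CondQuantity (conj_val_finite F x (val S)) (conj_hyp_neq0 F S).

(** The assessment [x] enters twice: in the values of the conjunctions and as
    their previsions. *)
Definition conj_coherent (Omega : Type) (R : realType) (n : nat)
    (F : 'I_n -> cond_event Omega) (x : {set 'I_n} -> R) : Prop :=
  coherent (conjunction F x) (fun S : nonempty_set n => x (val S)).

(** Coherence of the assessment [a] on the conjunctions indexed by [D] only. *)
Definition conj_coherent_on (Omega : Type) (R : realType) (n : nat)
    (F : 'I_n -> cond_event Omega) (D : {set {set 'I_n}})
    (a : {set 'I_n} -> R) : Prop :=
  exists2 x : {set 'I_n} -> R, conj_coherent F x & {in D, x =1 a}.

(* Main.v *)
Require Import Defs.
From mathcomp Require Import all_boot all_order all_algebra.
From mathcomp Require Import all_classical all_reals.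
From mathcomp Require Import numfun.

(** Both sides of the equivalence reduce to one combinatorial condition, which
    mentions no number: every nonempty set [S] of indices is _tolerated_, that
    is, at some point of [\bigcup_(i in S) H_i] no [E_i|H_i] with [i \in S] is
    false.

    For p-consistency, a bet on [E_i|H_i] at price [1] with a positive stake
    never wins, and it loses exactly when [E_i|H_i] is false. Hence unit
    stakes on the members of [S] avoid a sure loss only if [S] is tolerated
    ([p_consistent_tolerant]). Conversely, a point tolerating all the
    conditional events that are bet on makes the gain vanish, whatever the
    signs of the stakes ([tolerant_p_consistent]).

    If all sets are tolerated, the same argument shows that the constant
    assessment [1] is coherent on all conjunctions: with these previsions a
    conjunction takes the value [0] when a member is false and [1] otherwise,
    so the gain vanishes at a point tolerating the union of the index sets bet
    on ([tolerant_conj_coherent]). In particular the full conjunction gets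
    prevision [1].

    If some nonempty [S] is not tolerated, every coherent [x] has [x V = 0]
    for all [V] containing [S] ([not_tolerated_conj_prevision0]), hence
    prevision [0] instead of [1] for the full conjunction. The reason is that
    [C_V] is then constantly [0] on its conditioning event: where some [H_i],
    [i \in S], is true, a member of [S] is false; elsewhere all of [S] is void,
    and the value is [0] or the prevision of a smaller conjunction whose index
    set still contains [S]. *)

Set Implicit Arguments.
Unset Strict Implicit.
Unset Printing Implicit Defensive.

Import Order.TTheory GRing.Theory Num.Theory.
Local Open Scope classical_set_scope.
Local Open Scope ring_scope.

(** Satisfiability of the quasi conjunction of the members of [S], that is, of
    the conjunction of the material implications [H_i -> E_i] given that some
    [H_i] is true. *)
Definition tolerated (Omega : Type) (n : nat) (F : 'I_n -> cond_event Omega)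
    (S : {set 'I_n}) : Prop :=
  exists2 w, (\bigcup_(i in [set` S]) ce_hyp (F i)) w &
    forall i, i \in S -> ~ ce_false (F i) w.

Definition tolerant (Omega : Type) (n : nat) (F : 'I_n -> cond_event Omega) :=
  forall S : {set 'I_n}, S != finset.set0 -> tolerated F S.

Lemma finite_set_minimum (R : realType) (A : set R) :
  finite_set A -> A !=set0 -> exists m, is_minimum A m.
Proof.
move=> /finite_seqP[s ->] [a /= a_s].
exists (\big[Order.min/a]_(y <- s) y); split => /=.
  rewrite big_seq; apply: (big_ind (fun y => y \in s)) => // x y xs ys.
  by rewrite minEle; case: ifP.
by move=> y /= ys; exact: (ge_bigmin_seq a y xpredT id ys isT).
Qed.

Lemma finite_set_maximum (R : realType) (A : set R) :
  finite_set A -> A !=set0 -> exists M, is_maximum A M.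
Proof.
move=> Afin [a Aa].
have [||m [[y Ay <-] le_m]] := @finite_set_minimum R (-%R @` A).
- exact: finite_image.
- by exists (- a), a.
by exists y; split=> // z Az; rewrite -lerN2; apply: le_m; exists z.
Qed.

Section Gain.
Variables (Omega : Type) (R : realType).

Lemma gain_finite (r : nat) (Y : 'I_r -> cond_quantity Omega R)
    (mu s : 'I_r -> R) :
  finite_set (range (gain Y mu s)).
Proof.
suff H (l : seq 'I_r) : finite_set (range (fun w => \sum_(j <- l)
    s j * (\1_(cq_hyp (Y j)) w * (cq_val (Y j) w - mu j)))).
  exact: H.
elim: l => [|j l IH].
  apply: sub_finite_set (finite_set1 (0 : R)) => _ [w _ <-].
  by rewrite big_nil.
have fin := finite_image2
  (fun p a : R => s j * (p * (a - mu j)))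
  (indic_range_finite R (cq_hyp (Y j))) (cq_val_finite (Y j)).
apply: sub_finite_set (finite_image2 (fun a b : R => a + b) fin IH).
move=> _ [w _ <-]; rewrite big_cons.
exists (s j * (\1_(cq_hyp (Y j)) w * (cq_val (Y j) w - mu j))).
  exists (\1_(cq_hyp (Y j)) w); first by exists w.
  by exists (cq_val (Y j) w) => //; exists w.
by eexists; [exists w|].
Qed.

(** Gains have finitely many values, so the extrema demanded by coherence
    exist as soon as the set is nonempty; a zero of the gain places them on
    both sides of [0]. *)
Lemma gain_extrema (r : nat) (Y : 'I_r -> cond_quantity Omega R)
    (mu s : 'I_r -> R) (K : set Omega) (w : Omega) :
  K w -> gain Y mu s w = 0 ->
  exists m M : R, [/\ is_minimum (gain Y mu s @` K) m,
    is_maximum (gain Y mu s @` K) M & m <= 0 <= M].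
Proof.
move=> Kw gw0.
have fin : finite_set (gain Y mu s @` K).
  by apply: sub_finite_set (gain_finite Y mu s) => _ [u _ <-]; exists u.
have im0 : (gain Y mu s @` K) 0 by exists w.
have [|m mP] := finite_set_minimum fin; first by exists 0.
have [|M MP] := finite_set_maximum fin; first by exists 0.
by exists m, M; split=> //; rewrite (mP.2 _ im0) (MP.2 _ im0).
Qed.

(** A bet on [Y j] alone, with stake [1], would be a sure gain or a sure loss
    if the prevision differed from the only possible value. *)
Lemma coherent_constant (J : Type) (Y : J -> cond_quantity Omega R)
    (mu : J -> R) (j : J) (c : R) :
  coherent Y mu -> (forall w, cq_hyp (Y j) w -> cq_val (Y j) w = c) ->
  mu j = c.
Proof.
move=> coh Yc.
have [|m [M [[[u [_ _ Ku] <-] _] [[v [_ _ Kv] <-] _] /andP[]]]] :=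
  coh 1%N (fun=> j) (fun=> 1) isT.
  by move=> a b _; rewrite !ord1.
rewrite /gain !big_ord1 /= !indicE !mem_set // !mul1r !Yc //.
by rewrite subr_le0 subr_ge0 => le1 le2; apply/eqP; rewrite eq_le le1 le2.
Qed.

End Gain.

Section Consistency.
Variables (R : realType) (Omega : Type) (n : nat).
Variable (F : 'I_n -> cond_event Omega).

(** Unit stakes on the members of [S] give a gain equal to minus the number of
    false members, so a point where it is nonnegative tolerates [S]. *)
Lemma p_consistent_tolerant : p_consistent R F -> tolerant F.
Proof.
move=> coh S Sn0.
have card_gt0 : (0 < #|S|)%N by rewrite card_gt0.
have [_ [M [_ [[w [j _ Hw] <-] _] /andP[_ G_ge0]]]] :=
  coh _ _ (fun=> 1) card_gt0 (@enum_val_inj _ (mem S)).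
exists w; first by exists (enum_val j) => //; exact: enum_valP.
move=> i iS [nEi Hi].
suff : \sum_(k < #|S|) 1 * (\1_(ce_hyp (F (enum_val k))) w *
    (\1_(ce_event (F (enum_val k))) w - 1)) < 0 :> R.
  by rewrite ltNge (G_ge0 : is_true (0 <= \sum_(k < #|S|) _)).
(* A false [F i] costs the whole stake, and no other bet can make up for it. *)
rewrite (bigD1 (enum_rank_in iS i)) //= enum_rankK_in //.
rewrite !indicE (mem_set Hi) memNset // !mul1r sub0r.
apply: (@le_lt_trans _ _ (-1 + 0)); last by rewrite addr0 ltrN10.
rewrite lerD2l; apply: sumr_le0 => k _.
by rewrite mul1r mulr_ge0_le0 // subr_le0 indicE; case: (_ \in _).
Qed.

(** At price [1], a bet on a true or a void conditional event breaks even, so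
    negative stakes need no separate treatment. *)
Lemma tolerant_p_consistent : tolerant F -> p_consistent R F.
Proof.
move=> tolF r t s r_gt0 _ G K.
have [|w [_ /imsetP[j _ ->] Hj] nf] := tolF [set t j | j in 'I_r]%SET.
  by apply/set0Pn; exists (t (Ordinal r_gt0)); exact: imset_f.
apply: (@gain_extrema _ _ _ _ _ _ K w); first by exists j.
rewrite /gain big1 // => k _ /=; rewrite !indicE.
have [Hk|nHk] := pselect (ce_hyp (F (t k)) w); last first.
  by rewrite (memNset nHk) mul0r mulr0.
have [Ek|nEk] := pselect (ce_event (F (t k)) w).
  by rewrite (mem_set Ek) subrr !mulr0.
by case: (nf (t k)) => //; exact: imset_f.
Qed.

Lemma conj_val_no_false (S : {set 'I_n}) (w : Omega) :
  (forall i, i \in S -> ~ ce_false (F i) w) ->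
  conj_val F (fun=> 1 : R) S w = 1.
Proof.
move=> nf; rewrite /conj_val; case: ifP => // _.
by case: existsP => // -[i /andP[iS /set_mem /(nf i iS)]].
Qed.

Lemma conj_val_false (x : {set 'I_n} -> R) (S : {set 'I_n}) (w : Omega) i :
  i \in S -> ce_false (F i) w -> conj_val F x S w = 0.
Proof.
move=> iS fi; rewrite /conj_val; case: ifP => [/forallP/(_ i)|_].
  by rewrite iS => /set_mem[Ei _]; case: fi.
by case: existsP => // -[]; exists i; rewrite iS mem_set.
Qed.

Lemma tolerant_conj_coherent : tolerant F -> conj_coherent F (fun=> 1 : R).
Proof.
move=> tolF r t s r_gt0 _ G K.
have [|w [i /bigcupP[j _ ij] Hi] nf] := tolF (\bigcup_(j < r) val (t j))%SET.
  have /set0Pn[i it] := valP (t (Ordinal r_gt0)).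
  by apply/set0Pn; exists i; apply/bigcupP; exists (Ordinal r_gt0).
apply: (@gain_extrema _ _ _ _ _ _ K w); first by exists j => //; exists i.
rewrite /gain big1 // => k _ /=; rewrite conj_val_no_false ?subrr ?mulr0 //.
by move=> l lk; apply: nf; apply/bigcupP; exists k.
Qed.

(** The statement ranges over all supersets of [S], rather than the full index
    set alone, for the induction on [#|V|]: where all of [S] is void, [C_V]
    may take the prevision of a smaller conjunction as its value. *)
Lemma not_tolerated_conj_prevision0 (x : {set 'I_n} -> R) (S V : {set 'I_n}) :
  conj_coherent F x -> S != finset.set0 -> ~ tolerated F S ->
  S \subset V -> x V = 0.
Proof.
move=> coh Sn0 ntol.
have [m] := ubnP #|V|; elim: m V => // m IH V ltVm SV.
have Vn0 : V != finset.set0.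
  by apply: contraNneq Sn0 => V0; rewrite -finset.subset0 -V0.
apply: (@coherent_constant _ _ _ _ _ (exist _ V Vn0) _ coh) => w /= [j jV Hj].
have [[i iS fi]|nf] := pselect (exists2 i, i \in S & ce_false (F i) w).
  by apply: conj_val_false fi; exact: (fintype.subsetP SV).
have voidS i : i \in S -> ~ ce_hyp (F i) w.
  move=> iS Hi; apply: ntol; exists w; first by exists i.
  by move=> k kS fk; apply: nf; exists k.
rewrite /conj_val; case: ifP => [/forallP allT|_].
  have /set0Pn[i iS] := Sn0.
  have := allT i.
  by rewrite (fintype.subsetP SV) // => /set_mem[_ /(voidS _ iS)].
case: ifP => // _; apply: IH.
  (* [j] is not void at [w], so the void indices form a proper subset. *)
  rewrite ltnS in ltVm; apply: leq_trans ltVm.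
  apply: proper_card; apply/properP; split.
    by apply/fintype.subsetP => k; rewrite inE => /andP[].
  by exists j => //; rewrite inE negb_and orbC memNset // => /(_ Hj).
apply/fintype.subsetP => i iS.
by rewrite inE (fintype.subsetP SV) // mem_set //; exact: voidS.
Qed.

End Consistency.

Theorem theorem17 (R : realType) (Omega : Type) (n : nat) (n_gt0 : (0 < n)%N)
    (F : 'I_n -> cond_event Omega) :
  p_consistent R F <->
  conj_coherent_on F [set [set: 'I_n]]%SET (fun=> 1%R : R).
Proof.
split=> [pcF|[x coh x1]].
  exists (fun=> 1) => //; apply: tolerant_conj_coherent.
  exact: p_consistent_tolerant pcF.
apply: tolerant_p_consistent => S Sn0.
have [//|ntol] := pselect (tolerated F S).
have := not_tolerated_conj_prevision0 coh Sn0 ntol (finset.subsetT S).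
by rewrite x1 ?inE // => /eqP; rewrite oner_eq0.
Qed.
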